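(* Let $R=\{(1,2),(1,3),(2,1),(2,2),(2,3),(3,1),(3,2),(3,3)\}$. Then $(123,R)\sim_d(132,R)$.
   Context: $S_n$ denotes the set of permutations of $[n]=\{1,\dots,n\}$, written $\pi=\pi_1\cdots\pi_n$. A mesh pattern of length $k$ is a pair $(\tau,R)$ with $\tau\in S_k$ and $R\subseteq\{0,1,\dots,k\}^2$ (the shaded boxes; box $(a,b)$ is the unit square $[a,a+1]\times[b,b+1]$ in the diagram of $\tau$). An occurrence of $(\tau,R)$ in $\pi\in S_n$ is a choice of indices $i_1<\dots<i_k$ such that $\pi_{i_1}\cdots\pi_{i_k}$ is order-isomorphic to $\tau$ and, with $i_0=0$, $i_{k+1}=n+1$, $v_1<\dots<v_k$ the values $\pi_{i_1},\dots,\pi_{i_k}$ sorted increasingly, $v_0=0$, $v_{k+1}=n+1$, for every $(a,b)\in R$ there is no index $m$ with $i_a<m<i_{a+1}$ and $v_b<\pi_m<v_{b+1}$. Mesh patterns $p,q$ are equidistributed, $p\sim_d q$, if for all $n,\ell\ge0$ the number of $\pi\in S_n$ with exactly $\ell$ occurrences of $p$ equals the number with exactly $\ell$ occurrences of $q$. *)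

(* Defs.v *)
From mathcomp Require Import all_boot all_order all_fingroup.

Set Implicit Arguments.
Unset Strict Implicit.
Unset Printing Implicit Defensive.

(* Permutations of [n] are elements of 'S_n, acting on 'I_n = {0, ..., n-1};
   the index i : 'I_n stands for the integer i.+1 of [n], both as a position
   and as a value.  Boxes keep their usual coordinates in {0, ..., k}. *)
Record mesh_pattern (k : nat) := MeshPattern {
  mp_perm : 'S_k;
  mp_shaded : {set 'I_k.+1 * 'I_k.+1}
}.

(* From the 1-based coordinates x_1, ..., x_k, the list x_0, x_1, ..., x_{k+1}
   with x_0 = 0 and x_{k+1} = n + 1. *)
Definition with_bounds (n : nat) (s : seq nat) : seq nat := 0 :: rcons s n.+1.

Definition occ_positions (n k : nat) (f : {ffun 'I_k -> 'I_n}) : seq nat :=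
  with_bounds n [seq (f j).+1 | j <- enum 'I_k].

Definition occ_values (n k : nat) (pi : 'S_n) (f : {ffun 'I_k -> 'I_n}) :
    seq nat :=
  with_bounds n (sort leq [seq (pi (f j)).+1 | j <- enum 'I_k]).

(* m lies in the open interval between the a-th and (a+1)-st entries of s. *)
Definition in_gap (s : seq nat) (a m : nat) : bool :=
  nth 0 s a < m < nth 0 s a.+1.

Definition is_occurrence (n k : nat) (p : mesh_pattern k) (pi : 'S_n)
    (f : {ffun 'I_k -> 'I_n}) : bool :=
  [&& [forall i : 'I_k, forall j : 'I_k, (i < j) ==> (f i < f j)],
      [forall i : 'I_k, forall j : 'I_k,
         (pi (f i) < pi (f j)) == (mp_perm p i < mp_perm p j)]
    & [forall ab in mp_shaded p,
         ~~ [exists m : 'I_n, in_gap (occ_positions f) ab.1 m.+1 &&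
                              in_gap (occ_values pi f) ab.2 (pi m).+1]]].

Definition occurrences (n k : nat) (p : mesh_pattern k) (pi : 'S_n) : nat :=
  #|[set f : {ffun 'I_k -> 'I_n} | is_occurrence p pi f]|.

Definition equidistributed (k k' : nat)
    (p : mesh_pattern k) (q : mesh_pattern k') : Prop :=
  forall n l : nat,
    #|[set pi : 'S_n | occurrences p pi == l]| =
    #|[set pi : 'S_n | occurrences q pi == l]|.

Notation "p ~d q" := (equidistributed p q) (at level 70, no associativity).

Definition boxes (k : nat) (s : seq (nat * nat)) : {set 'I_k.+1 * 'I_k.+1} :=
  [set ab | (val ab.1, val ab.2) \in s].

Definition perm123 : 'S_3 := 1%g.
Definition perm132 : 'S_3 := tperm (inord 1) (inord 2).

Lemma perm123_one_line : [seq (perm123 i).+1 | i <- enum 'I_3] = [:: 1; 2; 3].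
Proof.
have -> : [seq (perm123 i).+1 | i <- enum 'I_3]
        = [seq x.+1 | x <- [seq val i | i <- enum 'I_3]].
  by rewrite -map_comp; apply: eq_map => i; rewrite /= perm1.
by rewrite val_enum_ord.
Qed.

Lemma perm132_one_line : [seq (perm132 i).+1 | i <- enum 'I_3] = [:: 1; 3; 2].
Proof.
have -> : [seq (perm132 i).+1 | i <- enum 'I_3]
        = [seq nth 0 [:: 1; 3; 2] x | x <- [seq val i | i <- enum 'I_3]].
  rewrite -map_comp; apply: eq_map => -[[|[|[|//]]] lt_i3] /=;
  by rewrite permE /= -!val_eqE /= !inordK.
by rewrite val_enum_ord.
Qed.

(* Main.v *)
Require Import Defs.
From mathcomp Require Import all_boot all_order all_fingroup.
From mathcomp Require Import zify.

(** Each element [x] is the first point of at most one occurrence, and it is one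
    exactly when the elements to the upper right of [x] form a word whose last
    two letters are its two largest ones, in increasing order for 123 and in
    decreasing order for 132.  Build a permutation by successively inserting a
    new minimum.  Inserting it before at least two letters creates an
    occurrence or not according to the suffix that follows it, and does not
    affect which two letters are last.  Inserting it in the last position makes
    the last two letters decreasing, and in the last but one position makes them
    increasing; in both cases the suffix of length two is the only one that ends
    with its two largest letters.  Hence exchanging these two insertion
    positions at every step exchanges the two statistics. *)

(** * The statistic on words *)

(* [o = true] corresponds to 123 and [o = false] to 132. *)
Definition ends_with_top2 (o : bool) (s : seq nat) : bool :=
  if rev s is z :: y :: r then ((y < z) == o) && all (fun w => w < minn y z) r
  else false.

Fixpoint occ (o : bool) (s : seq nat) : nat :=
  if s is x :: s' then ends_with_top2 o [seq w <- s' | x < w] + occ o s' else 0.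

Lemma ends_with_top2_rcons2 o s y z :
  ends_with_top2 o (rcons (rcons s y) z) =
  ((y < z) == o) && all (fun w => w < minn y z) s.
Proof. by rewrite /ends_with_top2 !rev_rcons all_rev. Qed.

Lemma ends_with_top2_small o s : size s < 2 -> ends_with_top2 o s = false.
Proof. by case: s => [|x [|y s]]. Qed.

Lemma ends_with_top2_map_succ o s :
  ends_with_top2 o (map succn s) = ends_with_top2 o s.
Proof.
case/lastP: s => [//|s z]; case/lastP: s => [//|s y].
rewrite !map_rcons !ends_with_top2_rcons2 all_map ltnS; congr (_ && _).
by apply: eq_all => w /=; rewrite minnSS ltnS.
Qed.

Lemma ends_with_top2_drop_succ o m s :
  ends_with_top2 o (drop m (map succn s)) = ends_with_top2 o (drop m s).
Proof. by rewrite -map_drop ends_with_top2_map_succ. Qed.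

Lemma occ_map_succ o s : occ o (map succn s) = occ o s.
Proof.
elim: s => //= x s ->; rewrite filter_map ends_with_top2_map_succ.
by congr (ends_with_top2 _ _ + _).
Qed.

(** * Insertion of a new minimum *)

Definition insert0 (i : nat) (t : seq nat) : seq nat :=
  take i t ++ 0 :: drop i t.

(** The new 0 is in the upper right of no letter of [s1], and its own upper right is all of [s2]. *)
Lemma occ_cat0 o s1 s2 : all (leq 1) s1 -> all (leq 1) s2 ->
  occ o (s1 ++ 0 :: s2) = occ o (s1 ++ s2) + ends_with_top2 o s2.
Proof.
move=> s1_gt0 s2_gt0; elim: s1 s1_gt0 => [_|x s1 IHs /= /andP[x_gt0 s1_gt0]] /=.
  by rewrite (all_filterP s2_gt0) addnC.
by rewrite (IHs s1_gt0) !filter_cat /= addnA.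
Qed.

Lemma occ_insert0 o i t : all (leq 1) t ->
  occ o (insert0 i t) = occ o t + ends_with_top2 o (drop i t).
Proof.
rewrite -{1 3}[t](cat_take_drop i) all_cat => /andP[t1_gt0 t2_gt0].
exact: occ_cat0.
Qed.

Lemma drop_insert0 m i t : i <= size t ->
  drop m (insert0 i t) = if m <= i then drop m (take i t) ++ 0 :: drop i t
                         else drop m.-1 t.
Proof.
move=> le_it; rewrite /insert0 drop_cat size_takel //.
case: (ltngtP m i) => [//|lt_im|->].
  rewrite -(subnSK lt_im) /= drop_drop; congr drop; lia.
by rewrite subnn drop0 [drop i (take i t)]drop_oversize ?size_takel.
Qed.

(** If at least two letters follow the 0, it is smaller than the last two and its presence in a
    suffix does not matter; [m - (i < m)] corrects the index. Otherwise any suffix with at least two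
    letters has 0 as the smaller of its last two, so nothing may precede them: its length is two,
    and it increases exactly when 0 is last but one. *)
Lemma ends_with_top2_drop_insert0 o m i t : all (leq 1) t -> i <= size t ->
  ends_with_top2 o (drop m (insert0 i t)) =
  if i.+2 <= size t then ends_with_top2 o (drop (m - (i < m)) t)
  else (m.+1 == size t) && (o == (i.+1 == size t)).
Proof.
move=> t_gt0 le_it; rewrite drop_insert0 //.
case: (leqP m i) => [le_mi|lt_im]; last first.
  rewrite subn1; case: ifP => // lt_ti.
  have -> : m.+1 == size t = false by lia.
  rewrite ends_with_top2_small // size_drop; lia.
have sz1 : size (drop m (take i t)) = i - m by rewrite size_drop size_takel.
have sz2 : size (drop i t) = size t - i by rewrite size_drop.
have t2_gt0 : all (leq 1) (drop i t).
  by apply/allP => x /mem_drop; apply: (allP t_gt0).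
have def_t : drop m t = drop m (take i t) ++ drop i t.
  by rewrite -{1}(cat_take_drop i t) drop_cat size_takel //;
     case: (ltngtP m i) le_mi => // -> _;
     rewrite subnn drop0 [drop i (take i t)]drop_oversize ?size_takel.
rewrite subn0 def_t.
move: (drop i t) (drop m (take i t)) sz1 sz2 t2_gt0 => s2 s1 sz1.
(* The cases are no letter, one letter, or at least two letters after the 0. *)
case/lastP: s2 => [|s2 z] /=.
  move=> sz2 _; have eq_it : i = size t by lia.
  have -> : i.+1 < size t = false by lia.
  rewrite cats1; case/lastP: s1 sz1 => [|s1 y] /=.
    by move=> sz1; rewrite ends_with_top2_small //; case: o; lia.
  rewrite size_rcons ends_with_top2_rcons2 minn0 ltn0 => sz1.
  by case: s1 sz1 => [|w s1] /=; case: o => /=; lia.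
case/lastP: s2 => [|s2 y] /=.
  move=> sz2; rewrite andbT => z_gt0.
  have eq_it : i.+1 = size t by lia.
  have -> : i.+1 < size t = false by lia.
  rewrite -[[:: 0; z]]/([:: 0] ++ [:: z]) catA !cats1 ends_with_top2_rcons2.
  by rewrite z_gt0 min0n; case: s1 sz1 => [|w s1] /=; case: o => /=; lia.
rewrite !size_rcons !all_rcons => sz2 /and3P[z_gt0 y_gt0 _].
have -> : i.+1 < size t by lia.
rewrite -rcons_cons -rcons_cons -!rcons_cat !ends_with_top2_rcons2 !all_cat /=.
by rewrite leq_min y_gt0 z_gt0.
Qed.

(** * Permutations as words *)

Definition word (n : nat) (s : 'S_n) : seq nat := [seq val (s i) | i <- enum 'I_n].

Lemma size_word n (s : 'S_n) : size (word n s) = n.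
Proof. by rewrite size_map size_enum_ord. Qed.

Lemma enum_ord_lift n (i : 'I_n.+1) :
  enum 'I_n.+1 = let t := [seq lift i j | j <- enum 'I_n] in
                 take i t ++ i :: drop i t.
Proof.
apply: (inj_map val_inj); rewrite /= map_cat /= map_take map_drop -map_comp.
rewrite (_ : map _ (enum 'I_n) = map (bump i) (iota 0 n)); last first.
  by rewrite -val_enum_ord -map_comp; apply: eq_map.
have le_in : i <= n by rewrite -ltnS.
rewrite val_enum_ord; move: (val i) le_in => {}i le_in.
rewrite -(subnKC le_in) -addnS !iotaD map_cat !add0n.
have -> : map (bump i) (iota 0 i) = iota 0 i.
  rewrite -[RHS]map_id; apply/eq_in_map => j; rewrite mem_iota /bump; lia.
have -> : map (bump i) (iota i (n - i)) = iota i.+1 (n - i).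
  rewrite -add1n iotaDl; apply/eq_in_map => j; rewrite mem_iota /bump; lia.
by rewrite take_size_cat ?drop_size_cat ?size_iota.
Qed.

(** [lift_perm i ord0 s] takes the value 0 at [i]; lifting the other values past 0 adds one to
    each. *)
Lemma word_lift_perm n (i : 'I_n.+1) (s : 'S_n) :
  word _ (lift_perm i ord0 s) = insert0 i (map succn (word n s)).
Proof.
rewrite /word /insert0 (enum_ord_lift _ i) /= map_cat /= map_take map_drop.
rewrite lift_perm_id /= -!map_comp.
suff /eq_map -> : (fun j => val (lift_perm i ord0 s (lift i j))) =1
    succn \o (fun j => val (s j)) by [].
by move=> j; rewrite lift_perm_lift.
Qed.

(** The position of the value 0 recovers [i], and the other values recover [s]; counting gives
    surjectivity. *)
Lemma lift_perm0_bij n :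
  bijective (fun u : 'I_n.+1 * 'S_n => lift_perm u.1 ord0 u.2).
Proof.
apply: inj_card_bij; last by rewrite card_prod !card_Sn card_ord factS.
move=> [i s] [j t] /= eq_st.
have eq_ij : i = j.
  apply: (perm_inj (s := lift_perm i ord0 s)).
  by rewrite lift_perm_id eq_st lift_perm_id.
rewrite -{}eq_ij in eq_st *; congr (_, _); apply/permP => k.
apply: (@lift_inj _ ord0).
by rewrite -(lift_perm_lift i) eq_st lift_perm_lift.
Qed.

(** * Exchanging the last two insertion positions *)

(** A word of length [n] has [n.+1] insertion places, the last two being [n.-1] and [n]; for [n = 0]
    this is the identity. *)
Definition swap_last2 (n : nat) : 'S_n.+1 := tperm (inord n.-1) ord_max.

Lemma swap_last2_id n (i : 'I_n.+1) : i.+2 <= n -> swap_last2 n i = i.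
Proof.
by move=> lt_in; rewrite tpermD // -val_eqE /= ?inordK; lia.
Qed.

Lemma swap_last2E n (i : 'I_n.+1) : 0 < n -> n < i.+2 ->
  swap_last2 n i = 2 * n - i.+1 :> nat.
Proof.
move=> n_gt0 lt_ni; have := ltn_ord i; rewrite /swap_last2.
case: tpermP => [->|->|] /=; rewrite ?inordK; try lia.
move=> /eqP; rewrite -val_eqE /= inordK; last by lia.
move=> ne1 /eqP; rewrite -val_eqE /=; lia.
Qed.

(** The claim on suffixes strengthens the induction: inserting 0 adds to [occ] the indicator of the
    suffix after it. *)
Lemma exists_occ_exchange n : exists2 phi : 'S_n -> 'S_n, injective phi &
  forall s, occ true (word n s) = occ false (word n (phi s)) /\
    forall m, ends_with_top2 true (drop m (word n s)) =
              ends_with_top2 false (drop m (word n (phi s))).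
Proof.
elim: n => [|n [phi phi_inj phiP]].
  exists id => // s; have := size_word 0 s.
  by case: (word 0 s).
have [g' gK g'K] := lift_perm0_bij n.
pose psi (u : 'I_n.+1 * 'S_n) := (swap_last2 n u.1, phi u.2).
pose g (u : 'I_n.+1 * 'S_n) := lift_perm u.1 ord0 u.2.
(* [g'] removes the minimum and records its place; [g] reinserts it after the exchange. *)
exists (g \o psi \o g').
  apply: inj_comp (can_inj g'K); apply: inj_comp (can_inj gK) _.
  by move=> [i s] [j t] [/perm_inj -> /phi_inj ->].
move=> s /=; rewrite -{1 3}[s]g'K; case: (g' s) => i t {s} /=.
rewrite /g /= !word_lift_perm.
have gt0 (u : 'S_n) : all (leq 1) (map succn (word n u)).
  by rewrite all_map; apply/allP.
have sz (u : 'S_n) : size (map succn (word n u)) = n by rewrite size_map size_word.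
have [occE topE] := phiP t; split=> [|m].
  rewrite !occ_insert0 // !occ_map_succ occE !ends_with_top2_drop_succ.
  have [lt_in|lt_ni] := leqP i.+2 n; first by rewrite swap_last2_id // topE.
  (* On both sides at most one letter follows the 0, which therefore starts no occurrence. *)
  rewrite !ends_with_top2_small // size_drop size_word; try lia.
  have [n0|n_gt0] := posnP n; first by lia.
  rewrite swap_last2E //; have := ltn_ord i; lia.
have le_n (j : 'I_n.+1) : j <= n by rewrite -ltnS.
rewrite !ends_with_top2_drop_insert0 ?sz //.
rewrite !ends_with_top2_drop_succ.
have [lt_in|lt_ni] := leqP i.+2 n; first by rewrite swap_last2_id // lt_in topE.
have [n0|n_gt0] := posnP n.
  have -> : m.+1 == n = false by lia.
  by rewrite ifN //; lia.
rewrite swap_last2E //; have le_in := le_n i.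
have -> : (2 * n - i.+1).+1 < n = false by lia.
(* Exactly one of [i] and its image is [n.-1], so increasing and decreasing endings are
   exchanged. *)
by congr (_ && _); lia.
Qed.

(** * Occurrences in terms of the upper right of their first point *)

Definition top_pair (n : nat) (o : bool) (pi : 'S_n) (x y z : 'I_n) : Prop :=
  [/\ [/\ x < y & y < z], pi x < pi y, pi x < pi z, (pi y < pi z) = o &
   forall w : 'I_n, x < w -> pi x < pi w -> w != y -> w != z ->
     [/\ w < y, pi w < pi y & pi w < pi z]].

Definition upper_right (n : nat) (pi : 'S_n) (x : 'I_n) : seq 'I_n :=
  [seq w : 'I_n <- enum 'I_n | (x < w) && (pi x < pi w)].

(** A general increasing list of positions, rather than [enum 'I_n], lets the induction run. *)
Lemma occ_map_sorted n o (pi : 'S_n) (V : seq 'I_n) :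
  sorted (fun i j : 'I_n => i < j) V ->
  occ o [seq val (pi w) | w <- V] =
  \sum_(x <- V) ends_with_top2 o
     [seq val (pi w) | w : 'I_n <- V & (x < w) && (pi x < pi w)].
Proof.
have lt_tr : transitive (fun i j : 'I_n => i < j) by move=> ? ? ?; apply: ltn_trans.
elim: V => [|x V IHV] /=; first by rewrite big_nil.
rewrite path_sortedE // => /andP[x_lt V_sorted].
rewrite big_cons IHV //= ltnn filter_map; congr (_ + _).
  (* All of [V] lies to the right of [x], so the test [x < w] is automatic there. *)
  congr (nat_of_bool (ends_with_top2 _ (map _ _))).
  by apply: eq_in_filter => w /(allP x_lt) /= ->.
apply: eq_big_seq => y /(allP x_lt) lt_xy.
by rewrite [y < x]ltnNge (ltnW lt_xy).
Qed.

Lemma sorted_enum_ord n : sorted (fun i j : 'I_n => i < j) (enum 'I_n).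
Proof.
by rewrite -(sorted_map (f := val) (e' := ltn)) val_enum_ord iota_ltn_sorted.
Qed.

Lemma occ_word_card n o (pi : 'S_n) :
  occ o (word n pi) =
  #|[set x | ends_with_top2 o [seq val (pi w) | w <- upper_right n pi x]]|.
Proof.
rewrite /word occ_map_sorted ?sorted_enum_ord // big_enum /=.
by rewrite -sum1dep_card [RHS]big_mkcond /=; apply: eq_bigr => x _; case: ifP.
Qed.

Lemma ends_with_top2P n o (pi : 'S_n) x :
  reflect (exists y z, top_pair n o pi x y z)
    (ends_with_top2 o [seq val (pi w) | w <- upper_right n pi x]).
Proof.
have lt_tr : transitive (fun i j : 'I_n => i < j) by move=> ? ? ?; apply: ltn_trans.
have memV w : (w \in upper_right n pi x) = (x < w) && (pi x < pi w).
  by rewrite mem_filter mem_enum andbT.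
have V_sorted : sorted (fun i j : 'I_n => i < j) (upper_right n pi x).
  exact/sorted_filter/sorted_enum_ord.
apply: (iffP idP) => [|[y [z [[lt_xy lt_yz] pi_xy pi_xz pi_yz others]]]].
  move: (upper_right n pi x) memV V_sorted => V.
  case/lastP: V => [//|V z]; case/lastP: V => [//|V y] memV.
  rewrite sorted_pairwise // !pairwise_rcons !all_rcons.
  move=> /and3P[/andP[lt_yz _] lt_y _].
  rewrite !map_rcons ends_with_top2_rcons2 all_map => /andP[/eqP pi_yz pi_lt].
  have := memV y; rewrite !(mem_rcons, inE) eqxx orbT => /esym/andP[lt_xy pi_xy].
  have := memV z; rewrite !(mem_rcons, inE) eqxx => /esym/andP[lt_xz pi_xz].
  exists y, z; split=> // w lt_xw pi_xw /negPf w_y /negPf w_z.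
  have := memV w; rewrite !(mem_rcons, inE) w_y w_z lt_xw pi_xw /= => Vw.
  have /= := allP pi_lt w Vw; rewrite leq_min => /andP[].
  by split=> //; apply: (allP lt_y w Vw).
have -> : upper_right n pi x =
    rcons (rcons [seq w : 'I_n <- upper_right n pi x | w < y] y) z.
  (* Both lists strictly increase in position, so only their members need comparing. *)
  apply: (irr_sorted_eq lt_tr) => // [i||w].
  - exact: ltnn.
  - rewrite sorted_pairwise // !pairwise_rcons all_rcons lt_yz /=.
    rewrite filter_all -sorted_pairwise // sorted_filter // andbT /= andbT.
    by apply/allP => w; rewrite mem_filter => /andP[lt_wy _]; apply: ltn_trans lt_yz.
  rewrite memV !(mem_rcons, inE) mem_filter memV.
  have [->|w_z] := eqVneq w z; first by rewrite pi_xz (ltn_trans lt_xy).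
  have [->|w_y] := eqVneq w y; first by rewrite pi_xy lt_xy.
  have [lt_xw|] := boolP (x < w); last by rewrite andbF.
  have [pi_xw|] := boolP (pi x < pi w); last by rewrite /= andbF.
  by have [-> _ _] := others w lt_xw pi_xw w_y w_z.
rewrite !map_rcons ends_with_top2_rcons2 pi_yz eqxx /= all_map.
apply/allP => w; rewrite mem_filter memV /= => /and3P[lt_wy lt_xw pi_xw].
have w_y : w != y by rewrite -val_eqE ltn_eqF.
have w_z : w != z by rewrite -val_eqE ltn_eqF // (ltn_trans lt_wy).
by have [_ ? ?] := others w lt_xw pi_xw w_y w_z; rewrite leq_min; apply/andP.
Qed.

(** The positions suffice: [y] and [z] are the two rightmost points of the upper right of [x]. *)
Lemma top_pair_uniq n o (pi : 'S_n) x y z y' z' :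
  top_pair n o pi x y z -> top_pair n o pi x y' z' -> y = y' /\ z = z'.
Proof.
move=> [[xy yz] pxy pxz _ H] [[xy' yz'] pxy' pxz' _ H'].
have xz := ltn_trans xy yz; have xz' := ltn_trans xy' yz'.
have before (w u v : 'I_n) :
    (w != u -> w != v -> [/\ w < u, pi w < pi u & pi w < pi v]) ->
    [\/ w = u :> nat, w = v :> nat | w < u].
  have [->|w_u] := eqVneq w u; first by constructor 1.
  have [->|w_v] := eqVneq w v; first by constructor 2.
  by move=> /(_ isT isT)[]; constructor 3.
have [] := (before _ _ _ (H y' xy' pxy'), before _ _ _ (H z' xz' pxz')).
have [] := (before _ _ _ (H' y xy pxy), before _ _ _ (H' z xz pxz)).
by move=> [] ? [] ? [] ? [] ?; split; apply: val_inj => /=; lia.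
Qed.

(** * Shaded boxes and mesh pattern occurrences *)

Definition shading : seq (nat * nat) :=
  [:: (1, 2); (1, 3); (2, 1); (2, 2); (2, 3); (3, 1); (3, 2); (3, 3)].

(** Among the nine boxes to the upper right of [x], only (1,1) is unshaded, and it is the region
    left of [y] and below both [y] and [z]. *)
Lemma shading_empty_iff o n x y z px py pz w pw :
  x < y -> y < z -> px < py -> px < pz -> (py < pz) = o -> w < n -> pw < n ->
  (w == y) = (pw == py) -> (w == z) = (pw == pz) ->
  let pos := [:: 0; x.+1; y.+1; z.+1; n.+1] in
  let vals := if o then [:: 0; px.+1; py.+1; pz.+1; n.+1]
              else [:: 0; px.+1; pz.+1; py.+1; n.+1] in
  all (fun ab => ~~ (in_gap pos ab.1 w.+1 && in_gap vals ab.2 pw.+1)) shading =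
  [&& x < w, px < pw, w != y & w != z] ==> [&& w < y, pw < py & pw < pz].
Proof.
move=> xy yz pxy pxz pyz w_n pw_n wy wz.
(* All comparisons reduce to eight Booleans; the facts below are the order constraints that make a
   check of all their values succeed. *)
have mono_pos : [&& (z < w) ==> (y < w) & (y < w) ==> (x < w)] by lia.
have mono_val : [&& (pz < pw) ==> (px < pw), (py < pw) ==> (px < pw) &
  if o then (pz < pw) ==> (py < pw) else (py < pw) ==> (pz < pw)].
  by case: o pyz; lia.
have [ay az] : (w < y) = ~~ (y < w) && (w != y) /\ 
               (w < z) = ~~ (z < w) && (w != z) by lia.
have [bY bZ] : (pw < py) = ~~ (py < pw) && (w != y) /\
               (pw < pz) = ~~ (pz < pw) && (w != z) by lia.
have at_y : (w == y) ==> [&& ~~ (y < w), ~~ (py < pw) & (pz < pw) == ~~ o].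
  by case: o pyz {mono_val}; lia.
have at_z : (w == z) ==> [&& ~~ (z < w), y < w, ~~ (pz < pw) & (py < pw) == o].
  by case: o pyz {mono_val at_y}; lia.
case: o {pyz} mono_val at_y at_z => mono_val at_y at_z;
rewrite /in_gap /= !ltnS w_n pw_n ay az bY bZ;
by move: (x < w) (y < w) (z < w) (px < pw) (py < pw) (pz < pw) (w == y) (w == z)
     mono_pos mono_val at_y at_z => [] [] [] [] [] [] [] [].
Qed.

Lemma enum_ord3 : enum 'I_3 = [:: inord 0; inord 1; inord 2].
Proof. by apply: (inj_map val_inj); rewrite val_enum_ord /= !inordK. Qed.

Lemma ord3_ind (P : 'I_3 -> Prop) :
  P (inord 0) -> P (inord 1) -> P (inord 2) -> forall i, P i.
Proof. by move=> P0 P1 P2 i; rewrite -[i]inord_val; case: i => [[|[|[|//]]] lt_i]. Qed.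

Lemma increasing3E n (f : {ffun 'I_3 -> 'I_n}) :
  [forall i : 'I_3, forall j : 'I_3, (i < j) ==> (f i < f j)] =
  (f (inord 0) < f (inord 1) < f (inord 2)).
Proof.
apply/'forall_forallP/andP => [lt_f|[xy yz]].
  by split; apply: (implyP (lt_f _ _)); rewrite !inordK.
have xz := ltn_trans xy yz.
by do 2![apply: ord3_ind]; rewrite !inordK //= ?xy ?yz ?xz.
Qed.

Lemma order_isomorphic3E n o (tau : 'S_3) (pi : 'S_n) (f : {ffun 'I_3 -> 'I_n}) :
  [seq val (tau i) | i <- enum 'I_3] = (if o then [:: 0; 1; 2] else [:: 0; 2; 1]) ->
  f (inord 1) != f (inord 2) ->
  [forall i : 'I_3, forall j : 'I_3,
     (pi (f i) < pi (f j)) == (tau i < tau j)] =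
  [&& pi (f (inord 0)) < pi (f (inord 1)), pi (f (inord 0)) < pi (f (inord 2))
    & (pi (f (inord 1)) < pi (f (inord 2))) == o].
Proof.
move=> tauE; rewrite -(inj_eq (@perm_inj _ pi)) -val_eqE /= => pi_yz.
have tau_val (k : 'I_3) : tau k = nth 0 (if o then [:: 0; 1; 2] else [:: 0; 2; 1]) k :> nat.
  by rewrite -tauE (nth_map k) ?size_enum_ord // nth_ord_enum.
apply/'forall_forallP/and3P => [iso|[xy xz /eqP yz]].
  rewrite (eqP (iso (inord 0) (inord 1))) (eqP (iso (inord 0) (inord 2))).
  rewrite (eqP (iso (inord 1) (inord 2))) !tau_val !inordK //.
  by case: (o).
do 2![apply: ord3_ind]; rewrite !tau_val !inordK // ?ltnn;
  by case: o yz {tauE tau_val} => /= yz; lia.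
Qed.

Lemma forall_boxes k (s : seq (nat * nat)) (P : nat -> nat -> bool) :
  all (fun ab => (ab.1 <= k) && (ab.2 <= k)) s ->
  [forall ab in boxes k s, P (val ab.1) (val ab.2)] = all (fun ab => P ab.1 ab.2) s.
Proof.
move=> s_le; apply/'forall_implyP/allP => [Ps [a b] s_ab|Ps [a b]].
  have /andP[/= a_le b_le] := allP s_le _ s_ab.
  have := Ps (inord a, inord b); rewrite inE /= !inordK //; exact.
by rewrite inE /= => /Ps.
Qed.

Lemma is_occurrenceP n o (tau : 'S_3) (pi : 'S_n) (f : {ffun 'I_3 -> 'I_n}) :
  [seq val (tau i) | i <- enum 'I_3] = (if o then [:: 0; 1; 2] else [:: 0; 2; 1]) ->
  reflect (top_pair n o pi (f (inord 0)) (f (inord 1)) (f (inord 2)))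
    (is_occurrence (MeshPattern tau (boxes 3 shading)) pi f).
Proof.
move=> tauE; rewrite /is_occurrence increasing3E /=.
have posE : occ_positions f = [:: 0; (f (inord 0)).+1; (f (inord 1)).+1;
                                  (f (inord 2)).+1; n.+1].
  by rewrite /occ_positions enum_ord3.
have valE : occ_values pi f = with_bounds n
    (sort leq [:: (pi (f (inord 0))).+1; (pi (f (inord 1))).+1; (pi (f (inord 2))).+1]).
  by rewrite /occ_values enum_ord3.
rewrite {}posE {}valE.
case: (boolP (_ < _ < _)) => [/andP[xy yz]|nlt] /=; last first.
  by constructor=> -[[xy yz] _ _ _ _]; rewrite xy yz in nlt.
rewrite (order_isomorphic3E _ _ _ _ _ tauE); last by rewrite -val_eqE ltn_eqF.
move: (f (inord 0)) (f (inord 1)) (f (inord 2)) xy yz => x y z xy yz {f}.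
case: (boolP [&& _, _ & _]) => [/and3P[pxy pxz /eqP pyz]|niso] /=; last first.
  by constructor=> -[_ pxy pxz pyz _]; rewrite pxy pxz pyz eqxx in niso.
set vals := with_bounds n _.
have {vals} -> : vals = if o then [:: 0; (pi x).+1; (pi y).+1; (pi z).+1; n.+1]
                   else [:: 0; (pi x).+1; (pi z).+1; (pi y).+1; n.+1].
  rewrite /vals; case: o pyz {tauE} => pyz.
    by rewrite sorted_sort //=; [exact: leq_trans | lia].
  (* Sorting ignores the initial order, and with [pi z] before [pi y] the list is already
     increasing. *)
  rewrite (_ : sort _ _ = sort leq [:: (pi x).+1; (pi z).+1; (pi y).+1]).
    by rewrite sorted_sort //=; [exact: leq_trans | lia].
  apply/(perm_sortP leq_total leq_trans anti_leq).
  by rewrite perm_cons (perm_catC [:: _] [:: _]).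
set pos := [:: 0; _; _; _; _]; set vals := if o then _ else _.
rewrite (forall_boxes _ _ (fun a b => ~~ [exists m : 'I_n,
  in_gap pos a m.+1 && in_gap vals b (pi m).+1])) //.
(* Emptiness is tested point by point; injectivity of [pi] matches equal positions with equal
   values. *)
have emptyE (w : 'I_n) :=
  shading_empty_iff o n x y z (pi x) (pi y) (pi z) w (pi w) xy yz pxy pxz pyz
    (ltn_ord w) (ltn_ord (pi w)) (esym (inj_eq (@perm_inj _ pi) w y))
    (esym (inj_eq (@perm_inj _ pi) w z)).
apply: (iffP idP) => [empty|[_ _ _ _ others]].
  split=> // w xw pxw w_y w_z.
  apply/and3P; refine (implyP (etrans (esym (emptyE w)) _) _); last by apply/and4P.
  by apply/allP => ab /(allP empty) /existsPn.
apply/allP => ab s_ab; apply/existsPn => w; move: ab s_ab; apply/allP.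
rewrite emptyE; apply/implyP => /and4P[xw pxw w_y w_z]; apply/and3P.
exact: others.
Qed.

(** An occurrence is determined by its first point, so counting occurrences amounts to counting
    first points. *)
Lemma occurrences_word n o (tau : 'S_3) (pi : 'S_n) :
  [seq val (tau i) | i <- enum 'I_3] = (if o then [:: 0; 1; 2] else [:: 0; 2; 1]) ->
  occurrences (MeshPattern tau (boxes 3 shading)) pi = occ o (word n pi).
Proof.
move=> tauE; rewrite occ_word_card /occurrences.
rewrite -(card_in_imset (f := fun f : {ffun 'I_3 -> 'I_n} => f (inord 0))).
  apply: eq_card => x; rewrite inE; apply/imsetP/ends_with_top2P => [[f]|[y [z xyz]]].
    by rewrite inE => /(is_occurrenceP _ _ _ _ _ tauE) ? ->; exists (f (inord 1)), (f (inord 2)).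
  exists [ffun i : 'I_3 => nth x [:: x; y; z] i]; last by rewrite ffunE inordK.
  by rewrite inE; apply/(is_occurrenceP _ _ _ _ _ tauE); rewrite !ffunE !inordK.
move=> f g; rewrite !inE.
move=> /(is_occurrenceP _ _ _ _ _ tauE) + /(is_occurrenceP _ _ _ _ _ tauE) + eq0.
rewrite -eq0 => topf topg; have [eq1 eq2] := top_pair_uniq _ _ _ _ _ _ _ _ topf topg.
apply/ffunP => i; rewrite -[i]inord_val.
by case: i => [[|[|[|//]]] lt_i].
Qed.

Theorem theorem4p6 :
  let R := boxes 3 [:: (1, 2); (1, 3); (2, 1); (2, 2); (2, 3);
                       (3, 1); (3, 2); (3, 3)] in
  MeshPattern perm123 R ~d MeshPattern perm132 R.
Proof.
move=> R n l; rewrite {}/R -/shading.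
have [phi phi_inj phiP] := exists_occ_exchange n.
(* The injection [phi] preserves the size of a level set under preimage. *)
rewrite -(card_preimset [set pi | _ (MeshPattern perm132 _) pi == l] phi_inj).
apply: eq_card => pi; rewrite !inE.
rewrite (occurrences_word _ true) ?(occurrences_word _ false).
- by have [-> _] := phiP pi.
(* [predn] turns the one-line notation with values from 1 into values from 0. *)
- have /(congr1 (map predn)) := perm132_one_line; rewrite -map_comp /= => <-.
  exact: eq_map.
have /(congr1 (map predn)) := perm123_one_line; rewrite -map_comp /= => <-.
exact: eq_map.
Qed.
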